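(* Let $G$ be a canonical weighted graph with labeled graph groupoid $\mathbb{G}$, and let $T_G$ be the labeling operator of $\mathbb{G}$ on the graph Hilbert space $H_G$. Then $T_G$ is identified with the operator generated by all edges of the shadowed graph $\widehat G$: $$T_G=\sum_{e\in E(\widehat G)}R_e .$$
   Context: $G$ is a countable directed graph with vertex set $V(G)$ and edge set $E(G)$, locally finite (every vertex has finitely many incident edges) and connected (any two distinct vertices are joined by a reduced finite path of $\widehat G$, defined below). $\deg_{out}(v)$ is the number of edges of $E(G)$ with initial vertex $v$, and $N:=\max\{\deg_{out}(v):v\in V(G)\}$, assumed finite. The shadow $G^{-1}$ has the same vertices and the opposite edges $e^{-1}$, $e\in E(G)$; the shadowed graph $\widehat G$ has vertex set $V(G)$ and edge set $E(G)\sqcup E(G^{-1})$. The graph groupoid $\mathbb{G}$ consists of the empty word $\emptyset$, the vertices, and the reduced finite paths of $\widehat G$, with product given by concatenation followed by the reduction $ww^{-1}=v$, $w^{-1}w=v'$ for $w$ a path from $v$ to $v'$; non-composable products equal $\emptyset$. Labels: $x_j$ is the $j$-th standard basis vector of $\mathbb{C}^N$. For each vertex $v$ the edges of $G$ with initial vertex $v$ are given the distinct labels $x_1,\dots,x_{\deg_{out}(v)}$, and $e^{-1}$ gets minus the label of $e$. Write $\widetilde\omega(e)$ for the label of $e\in E(\widehat G)$. $G$ with these labels is a canonical weighted graph and $\mathbb{G}$ the labeled graph groupoid. $H_G$ is the Hilbert space with orthonormal basis $\{\xi_w\}$ indexed by the elements $w\neq\emptyset$ of $\mathbb{G}$, with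 $\xi_\emptyset=0$. For $w\in\mathbb{G}$ the right multiplication operator $R_w$ is $R_w\xi_{w'}=\xi_{w'w}$. Put $t_k=x_k$ and $t_{-k}=-x_k$ for $k=1,\dots,N$. The $k$-th labeling operator $T_k$ ($k=\pm1,\dots,\pm N$) sends $\xi_w$ to $\xi_{we}$ for the edge $e\in E(\widehat G)$ with $we\neq\emptyset$ and $\widetilde\omega(e)=t_k$ (summing over all such edges if there are several), and to $0$ if there is no such edge. The labeling operator is $T_G=\sum_{j=-N}^{-1}T_j+\sum_{i=1}^NT_i$. *)

(* Defs.v *)
From HB Require Import structures.
From mathcomp Require Import all_boot all_order all_algebra.
From mathcomp Require Import finmap.
From mathcomp Require Import all_classical all_reals ereal esum.
From mathcomp Require Export complex.

Set Implicit Arguments.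
Unset Strict Implicit.
Unset Printing Implicit Defensive.

Import Order.TTheory GRing.Theory Num.Theory.
Local Open Scope classical_set_scope.
Local Open Scope ring_scope.

(* Countable directed graphs; loops and multiple edges are allowed. *)
Record digraph := Digraph {
  vert : countType;
  edge : countType;
  src : edge -> vert;
  tgt : edge -> vert
}.

(* Edges of the shadowed graph: inl e is the edge e and inr e is its
   opposite e^-1, an edge distinct from all the others, even if e is a loop. *)
Notation hedge G := (edge G + edge G)%type.

Section Graph.
Variable G : digraph.

Definition out_edges (v : vert G) : set (edge G) := [set e | src e = v].
Definition in_edges (v : vert G) : set (edge G) := [set e | tgt e = v].

Definition locally_finite : Prop :=
  forall v : vert G, finite_set (out_edges v `|` in_edges v).

(* These counts are meaningful only when the sets of edges are finite. *)
Definition deg_out (v : vert G) : nat := #|` fset_set (out_edges v)|.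
Definition deg_in (v : vert G) : nat := #|` fset_set (in_edges v)|.

Definition max_deg_out (N : nat) : Prop :=
  (forall v : vert G, (deg_out v <= N)%N) /\ exists v : vert G, deg_out v = N.

Definition hsrc (e : hedge G) : vert G :=
  match e with inl e => src e | inr e => tgt e end.
Definition htgt (e : hedge G) : vert G :=
  match e with inl e => tgt e | inr e => src e end.
Definition hinv (e : hedge G) : hedge G :=
  match e with inl e => inr e | inr e => inl e end.

Lemma hinvK : involutive hinv. Proof. by case. Qed.
Lemma hsrc_inv e : hsrc (hinv e) = htgt e. Proof. by case: e. Qed.
Lemma htgt_inv e : htgt (hinv e) = hsrc e. Proof. by case: e. Qed.

Fixpoint walk (v : vert G) (s : seq (hedge G)) : bool :=
  if s is e :: s' then (hsrc e == v) && walk (htgt e) s' else true.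

Definition wend (v : vert G) (s : seq (hedge G)) : vert G := last v (map htgt s).

Definition reduced (s : seq (hedge G)) : bool :=
  sorted (fun e f => f != hinv e) s.

Definition cons_red (e : hedge G) (s : seq (hedge G)) : seq (hedge G) :=
  if s is f :: s' then if f == hinv e then s' else e :: s else [:: e].

Definition reduce (s : seq (hedge G)) : seq (hedge G) := foldr cons_red [::] s.

Lemma walk_cat v s t : walk v (s ++ t) = walk v s && walk (wend v s) t.
Proof. by elim: s v => //= e s IHs v; rewrite IHs andbA. Qed.

Lemma walk_reduce v s : walk v s -> walk v (reduce s).
Proof.
elim: s v => //= e s IHs v /andP[/eqP <- /IHs]; rewrite /cons_red.
case: (reduce s) => [|f t] /=; first by rewrite eqxx.
case/andP=> /eqP fe wt; case: eqP => [fE|_] /=; last by rewrite fe !eqxx.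
by move: wt; rewrite fE htgt_inv.
Qed.

Lemma reduced_reduce s : reduced (reduce s).
Proof.
elim: s => //= e s; rewrite /cons_red; case: (reduce s) => [|f t] //= rt.
case: ifP => [_|/negbT nf]; first exact: path_sorted rt.
by rewrite /reduced /= nf.
Qed.

(* The nonempty elements of the graph groupoid: (v, [::]) is the vertex v, and
   (v, s) with s nonempty is the reduced finite path s, which starts at v. *)
Definition is_gpath (p : vert G * seq (hedge G)) : bool :=
  walk p.1 p.2 && reduced p.2.

Record gpath := Gpath { gpval : vert G * seq (hedge G); gpathP : is_gpath gpval }.
HB.instance Definition _ := [isSub for gpval].
HB.instance Definition _ := [Countable of gpath by <:].

Definition gstart (w : gpath) : vert G := (gpval w).1.
Definition gend (w : gpath) : vert G := wend (gpval w).1 (gpval w).2.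

Definition connected : Prop :=
  forall v v' : vert G, v <> v' -> exists w : gpath, gstart w = v /\ gend w = v'.

(* The whole groupoid, None being the empty word. *)
Definition groupoid : Type := option gpath.

Lemma gconcat_subproof (w w' : gpath) : gend w = gstart w' ->
  is_gpath (gstart w, reduce ((gpval w).2 ++ (gpval w').2)).
Proof.
move=> ww'; apply/andP; split => /=; last exact: reduced_reduce.
apply: walk_reduce; rewrite walk_cat.
have /andP[-> _] := gpathP w; have /andP[+ _] := gpathP w'.
by rewrite -/(gend w) ww'.
Qed.

Definition gmul (x y : groupoid) : groupoid :=
  match x, y with
  | Some w, Some w' =>
      match gend w =P gstart w' with
      | ReflectT ww' => Some (Gpath (gconcat_subproof ww'))
      | ReflectF _ => None
      end
  | _, _ => None
  end.

Lemma gedge_subproof (e : hedge G) : is_gpath (hsrc e, [:: e]).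
Proof. by rewrite /is_gpath /= eqxx. Qed.

Definition gedge (e : hedge G) : groupoid := Some (Gpath (gedge_subproof e)).

End Graph.

(* The canonical labels: lab e = j stands for the basis vector of index j,
   indices starting from 0; so the edges leaving v receive injectively, hence
   bijectively, the labels of index 0, ..., deg_out v - 1. *)
Definition canonical_labeling (G : digraph) (N : nat) (lab : edge G -> 'I_N) :=
  forall v : vert G,
    (forall e, src e = v -> (lab e < deg_out v)%N) /\
    (forall e f, src e = v -> src f = v -> lab e = lab f -> e = f).

Section HilbertSpace.
Variables (R : realType) (I : choiceType).

(* l^2(I), as the square-summable functions among all functions I -> R[i]. *)
Definition sqnorm2 (f : I -> R[i]) : \bar R :=
  \esum_(i in [set: I]) (ComplexField.Normc.normc (f i) ^+ 2)%:E.

Definition ell2 (f : I -> R[i]) : Prop := (sqnorm2 f < +oo)%E.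

Definition basis_vec (i : I) : I -> R[i] := fun j => (j == i)%:R.

(* Unconditional convergence, in norm, of the sum of a family of vectors. *)
Definition has_sum (J : choiceType) (F : J -> I -> R[i]) (f : I -> R[i]) : Prop :=
  forall eps : R, 0 < eps ->
    exists A0 : {fset J}, forall A : {fset J}, (A0 `<=` A)%fset ->
      (sqnorm2 (f - \sum_(j <- A) F j)%R < (eps ^+ 2)%:E)%E.

(* The (graphs of) possibly unbounded, partially defined operators. *)
Definition operator : Type := (I -> R[i]) -> (I -> R[i]) -> Prop.

(* The operator sending the basis vector of index i to a i: it maps psi to the
   sum of the psi i *: a i, when this family is summable. *)
Definition op_of_basis (a : I -> I -> R[i]) : operator := fun psi phi =>
  [/\ ell2 psi, ell2 phi & has_sum (fun i => psi i *: a i) phi].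

(* The pointwise sum of a family of operators, converging in norm at each
   vector of the domain (that is, in the strong operator topology). *)
Definition op_sum (J : choiceType) (A : J -> operator) : operator := fun psi phi =>
  exists phi_ : J -> I -> R[i],
    [/\ forall j, A j psi (phi_ j), ell2 phi & has_sum phi_ phi].

End HilbertSpace.

Section GraphOperators.
Variables (R : realType) (G : digraph).

Definition xi (x : groupoid G) : gpath G -> R[i] :=
  if x is Some w then @basis_vec R (gpath G) w else 0.

Definition right_mul (x : groupoid G) : operator R (gpath G) :=
  op_of_basis (fun w => xi (gmul (Some w) x)).

Variables (N : nat) (lab : edge G -> 'I_N).

(* t false k is t_(k+1) and t true k is t_-(k+1). *)
Definition t (neg : bool) (k : 'I_N) : 'rV[R[i]]_N :=
  if neg then - delta_mx 0 k else delta_mx 0 k.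

Definition label (e : hedge G) : 'rV[R[i]]_N :=
  match e with inl e => delta_mx 0 (lab e) | inr e => - delta_mx 0 (lab e) end.

(* A finite sum in a locally finite graph. *)
Definition labeling_basis (neg : bool) (k : 'I_N) (w : gpath G) : gpath G -> R[i] :=
  \sum_(e \in [set e : hedge G |
                 gmul (Some w) (gedge e) <> None /\ label e = t neg k])
     xi (gmul (Some w) (gedge e)).

Definition labeling_op_k (neg : bool) (k : 'I_N) : operator R (gpath G) :=
  op_of_basis (labeling_basis neg k).

(* Bounded and everywhere defined when the in-degrees are bounded; with finite
   but unbounded in-degrees the operators of negative index are unbounded: the
   image of the basis vector of w has squared norm the number of its terms. *)
Definition labeling_op : operator R (gpath G) := fun psi phi =>
  exists phi_ : bool -> 'I_N -> gpath G -> R[i],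
    [/\ ell2 psi, forall neg k, labeling_op_k neg k psi (phi_ neg k) &
        phi = \sum_(j < N) phi_ true j + \sum_(i < N) phi_ false i].

End GraphOperators.

(* Main.v *)
From mathcomp Require Import all_boot all_order all_algebra.
From mathcomp Require Import finmap lra.
From mathcomp Require Import all_classical all_reals ereal esum.
Require Import Defs.

(** Right multiplication by an edge e is a bijection from the paths ending at
    the source of e onto the paths ending at its target, with inverse the right
    multiplication by e^-1.  So, in coordinates, [(R_e psi) u] is
    [psi (u e^-1)], read as 0 when [u e^-1] is the empty word: this is [pull].
    In the same way, the labeling operator of one label is given by the finite
    sum, over the edges e of this label that enter the end of u, of the
    [psi (u e^-1)]: this is [transfer].  Each edge has exactly one label, so T_G
    and the sum of the R_e have the same coordinates, and all that remains is
    the convergence in norm of the sum over the edges.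

    Since in-degrees may be unbounded, a sum of the R_e psi over part of the
    edges entering a vertex is not controlled by the norm of T_G psi alone:
    cancellations can occur.  The argument therefore works label by label, and
    uses what it means for psi to be in the domain of each T_k.
    - For a positive label, a path w extends by at most one edge of this label.
      Hence summing over the edges is a regrouping of the sum over the paths w
      of the vectors [psi w *: xi_(we)], which converges unconditionally because
      psi is in the domain ([edge_sum_out]).
    - For a negative label, at most one edge of this label enters a given
      vertex.  Hence the R_e psi have disjoint supports and are restrictions of
      the single vector T_k psi of l^2 ([edge_sum_in]).

    Vectors of finite support are in the domain of T_G because all the sums are
    finite.  When the degrees of the shadowed graph are bounded, a Schur test
    bounds [transfer] ([ssq_transfer]), and applied to the tails of psi it gives
    the unconditional convergence, so that T_G is everywhere defined.  The same
    test, for a set of edges reduced to e, shows that R_e is everywhere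
    defined. *)

Set Implicit Arguments.
Unset Strict Implicit.
Unset Printing Implicit Defensive.

Import Order.TTheory GRing.Theory Num.Theory.
Local Open Scope ring_scope.

(** * Finite sums *)

Lemma sum_pick (V : nmodType) (J : choiceType) (E : {fset J}) (c : option J)
    (x : J -> V) :
  \sum_(j <- E) (if c == Some j then x j else 0) =
  if c is Some j then if j \in E then x j else 0 else 0.
Proof.
case: c => [j|]; last by rewrite big1.
rewrite -big_mkcond /= -big_filter; case: ifP => jE.
  have -> : [seq j' <- E | Some j == Some j'] = [:: j].
    rewrite -(filter_pred1_uniq (fset_uniq E) jE); apply: eq_filter => j' /=.
    by rewrite [RHS]eq_sym.
  by rewrite big_seq1.
rewrite (_ : [seq _ <- _ | _] = [::]) ?big_nil //.
apply/eqP; rewrite -(negbK (_ == _)) -has_filter.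
by apply/negP => /hasP [j' j'E /eqP [jj']]; move: jE; rewrite jj' j'E.
Qed.

Lemma eq_big_support (V : nmodType) (J : eqType) (s t : seq J) (P : pred J)
    (F : J -> V) : uniq s -> uniq t ->
  (forall j, F j != 0 -> (j \in s) && (j \in t)) ->
  \sum_(j <- s | P j) F j = \sum_(j <- t | P j) F j.
Proof.
move=> us ut Fst.
have dropz r : \sum_(j <- r | P j) F j =
    \sum_(j <- [seq j <- r | F j != 0] | P j) F j.
  rewrite big_filter_cond big_mkcond [RHS]big_mkcond; apply: eq_bigr => j _ /=.
  by case: eqP => //= ->; case: (P j).
rewrite dropz [RHS]dropz; apply/perm_big/uniq_perm; rewrite ?filter_uniq // => j.
by rewrite !mem_filter; case: (boolP (F j != 0)) => // /Fst /andP [-> ->].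
Qed.

(** * Square-summable functions and unconditional sums *)

Section SquareSums.
Variable R : realType.
Implicit Types z : R[i].

Definition nsq z : R := ComplexField.Normc.normc z ^+ 2.

Lemma nsqE z : nsq z = complex.Re z ^+ 2 + complex.Im z ^+ 2.
Proof. by case: z => a b; rewrite /nsq /= sqr_sqrtr // addr_ge0 ?sqr_ge0. Qed.

Lemma nsq_ge0 z : 0 <= nsq z. Proof. exact: sqr_ge0. Qed.

Lemma nsq0 : nsq 0 = 0. Proof. by rewrite nsqE /= expr0n addr0. Qed.

Lemma nsqN z : nsq (- z) = nsq z.
Proof. by rewrite !nsqE; case: z => a b /=; rewrite !sqrrN. Qed.

Lemma nsq_le0 z : nsq z <= 0 -> z = 0.
Proof.
move=> z0; have : nsq z == 0 by rewrite eq_le z0 nsq_ge0.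
by rewrite sqrf_eq0 => /eqP/ComplexField.Normc.eq0_normc.
Qed.

Lemma nsqD z1 z2 : nsq (z1 + z2) <= 2 * nsq z1 + 2 * nsq z2.
Proof.
rewrite !nsqE; case: z1 => a b; case: z2 => c d /=.
have := sqr_ge0 (a - c); have := sqr_ge0 (b - d); nra.
Qed.

(** The factor [2 ^+ size s] is far from the optimal [size s], but a bound
    depending only on the size is enough for the Schur test. *)
Lemma nsq_sum (J : Type) (s : seq J) (F : J -> R[i]) :
  nsq (\sum_(j <- s) F j) <= 2 ^+ size s * \sum_(j <- s) nsq (F j).
Proof.
elim: s => [|j s IHs]; first by rewrite !big_nil nsq0 mulr0.
rewrite !big_cons /= exprS -mulrA mulrDr.
apply: (le_trans (nsqD _ _)); rewrite -(mulrDr 2) ler_pM2l // lerD //.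
by rewrite ler_peMl ?nsq_ge0 // exprn_ege1 // ler1n.
Qed.

Variable I : choiceType.
Implicit Types (f g : I -> R[i]) (A B : {fset I}).

Definition ssq B f : R := \sum_(i <- B) nsq (f i).

Lemma sub_ssq A B f : (A `<=` B)%fset -> ssq A f <= ssq B f.
Proof.
move=> AB; rewrite /ssq (big_fsetID _ (mem A) B) /=.
have -> : [fset x in B | x \in A]%fset = A.
  by apply/fsetP => x; rewrite !inE /= andb_idl // => /(fsubsetP AB).
by rewrite lerDl; apply: sumr_ge0 => i _; exact: nsq_ge0.
Qed.

Lemma ler_ssq B f g :
  (forall i, i \in B -> nsq (f i) <= nsq (g i)) -> ssq B f <= ssq B g.
Proof. by move=> fg; rewrite /ssq !big_seq; apply: ler_sum => i /fg. Qed.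

Lemma ssqD B f g : ssq B (f + g) <= 2 * ssq B f + 2 * ssq B g.
Proof.
rewrite /ssq !mulr_sumr -big_split /=; apply: ler_sum => i _; exact: nsqD.
Qed.

(** Bounds on the norm reduce to bounds on finite partial sums, so that only
    finite sums of reals have to be estimated and exchanged below. *)
Lemma sqnorm2_leP f (c : R) :
  (sqnorm2 f <= c%:E)%E <-> forall B, ssq B f <= c.
Proof.
split=> [fc B|fc].
  rewrite -lee_fin; apply: le_trans fc; apply: esum_ge.
  exists [set` B]%classic; first by split.
  by rewrite fsbig_finite //= set_fsetK -sumEFin.
apply: ge_ereal_sup => _ [X [finX _] <-].
by rewrite fsbig_finite //= sumEFin lee_fin; exact: fc.
Qed.

Lemma ell2P f : ell2 f <-> exists c, forall B, ssq B f <= c.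
Proof.
split=> [f2|[c fc]]; last first.
  by apply: (@le_lt_trans _ _ c%:E); [exact/(sqnorm2_leP f c).2|exact: ltry].
have f0 : (0 <= sqnorm2 f)%E.
  by apply: esum_ge0 => i _; rewrite lee_fin; exact: nsq_ge0.
exists (fine (sqnorm2 f)); apply/sqnorm2_leP; rewrite fineK //.
by rewrite ge0_fin_numE.
Qed.

Lemma has_sumP (J : choiceType) (F : J -> I -> R[i]) f :
  has_sum F f <-> forall eps : R, 0 < eps -> exists A0 : {fset J},
    forall A : {fset J}, (A0 `<=` A)%fset ->
    forall B, ssq B (f - \sum_(j <- A) F j) <= eps.
Proof.
split=> Ff eps eps0.
  have [|A0 A0P] := Ff (Num.sqrt eps); first by rewrite sqrtr_gt0.
  exists A0 => A /A0P /ltW; rewrite sqr_sqrtr ?(ltW eps0) // => h B.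
  exact: ((sqnorm2_leP _ _).1 h B).
have [|A0 A0P] := Ff (eps ^+ 2 / 2); first by rewrite divr_gt0 ?exprn_gt0.
exists A0 => A /A0P /(sqnorm2_leP _ _).2 /le_lt_trans; apply.
by rewrite lte_fin ltr_pdivrMr // ltr_pMr ?exprn_gt0 // ltr1n.
Qed.

(** The tail of a square-summable series: a finite set that nearly realizes the
    supremum of the partial sums leaves at most [eps] outside of it. *)
Lemma ell2_tail f : ell2 f -> forall eps : R, 0 < eps -> exists A,
  forall g, (forall i, i \in A -> g i = 0) ->
    (forall i, nsq (g i) <= nsq (f i)) -> forall B, ssq B g <= eps.
Proof.
move=> /ell2P [c fc] eps eps0.
pose S := [set ssq B f | B in [set: {fset I}]]%classic.
have supS : has_sup S.
  split; first by exists (ssq fset0 f); exists fset0.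
  by exists c => _ [B _ <-]; exact: fc.
have [_ [A _ <-] supA] := sup_adherent eps0 supS.
exists A => g gA gf B.
have -> : ssq B g = ssq (B `\` A)%fset g.
  rewrite /ssq (big_fsetID _ (mem A) B) /= big1_fset ?add0r => [|i].
    rewrite (_ : [fset x in B | ~~ (x \in A)]%fset = (B `\` A)%fset) //.
    by apply/fsetP => x; rewrite !inE /= andbC.
  by rewrite !inE /= => /andP [_ /gA ->] _; rewrite nsq0.
apply: (@le_trans _ _ (ssq (B `\` A)%fset f)); first exact: ler_ssq.
have : ssq (A `|` B)%fset f <= sup S.
  by apply: ub_le_sup; [case: supS | exists (A `|` B)%fset].
have -> : ssq (A `|` B)%fset f = ssq A f + ssq (B `\` A)%fset f.
  rewrite /ssq (big_fsetID _ (mem A)) /=; congr (_ + _); apply: congr_big => //;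
    congr enum_fset; apply/fsetP => x; rewrite !inE /=;
    by case: (x \in A); case: (x \in B).
lra.
Qed.

Lemma ell2_0 : ell2 (0 : I -> R[i]).
Proof.
by apply/ell2P; exists 0 => B; rewrite /ssq big1 // => i _; exact: nsq0.
Qed.

Lemma ell2D f g : ell2 f -> ell2 g -> ell2 (f + g).
Proof.
move=> /ell2P [c fc] /ell2P [d gd]; apply/ell2P; exists (2 * c + 2 * d) => B.
by apply: (le_trans (ssqD _ _ _)); rewrite lerD // ler_pM2l.
Qed.

Lemma ell2_finite f (A : {fset I}) : (forall i, i \notin A -> f i = 0) -> ell2 f.
Proof.
move=> fA; apply/ell2P; exists (ssq A f) => B.
rewrite {1}/ssq (big_fsetID _ (mem A) B) /= [X in _ + X]big1_fset ?addr0 => [|i].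
  by apply: sub_ssq; apply/fsubsetP => i; rewrite !inE /= => /andP[].
by rewrite !inE /= => /andP [_ /fA ->] _; rewrite nsq0.
Qed.

Section Families.
Variable J : choiceType.
Implicit Types F : J -> I -> R[i].

Lemma has_sum0 : has_sum (0 : J -> I -> R[i]) (0 : I -> R[i]).
Proof.
apply/has_sumP => eps eps0; exists fset0 => A _ B; rewrite big1 // subr0 /ssq.
by rewrite big1 ?ltW // => i _; exact: nsq0.
Qed.

Lemma has_sumD F1 F2 f1 f2 :
  has_sum F1 f1 -> has_sum F2 f2 -> has_sum (F1 + F2) (f1 + f2).
Proof.
move=> /has_sumP s1 /has_sumP s2; apply/has_sumP => eps eps0.
have [|A1 A1P] := s1 (eps / 4); first by rewrite divr_gt0.
have [|A2 A2P] := s2 (eps / 4); first by rewrite divr_gt0.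
exists (A1 `|` A2)%fset => A; rewrite fsubUset => /andP [/A1P h1 /A2P h2] B.
rewrite big_split opprD addrACA; apply: (le_trans (ssqD _ _ _)).
have := h1 B; have := h2 B; lra.
Qed.

Lemma has_sum_big (K : Type) (s : seq K) (F : K -> J -> I -> R[i])
    (f : K -> I -> R[i]) :
  (forall k, has_sum (F k) (f k)) ->
  has_sum (\sum_(k <- s) F k) (\sum_(k <- s) f k).
Proof.
move=> Ff; elim: s => [|k s IHs]; first by rewrite !big_nil; exact: has_sum0.
by rewrite !big_cons; exact: has_sumD.
Qed.

(** Convergence in norm implies convergence of each coordinate; here the
    coordinate is eventually constant. *)
Lemma has_sum_at F f i c (A0 : {fset J}) : has_sum F f ->
  (forall A : {fset J}, (A0 `<=` A)%fset -> \sum_(j <- A) F j i = c) -> f i = c.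
Proof.
move=> /has_sumP Ff Fc; apply/eqP; rewrite -subr_eq0; apply/eqP/nsq_le0.
apply/ler_addgt0Pr => eps /Ff [A1 A1P]; rewrite add0r.
have := A1P (A0 `|` A1)%fset (fsubsetUr _ _) [fset i]%fset.
by rewrite /ssq big_seq_fset1 fct_sumE /GRing.add /= /GRing.opp /= Fc ?fsubsetUl.
Qed.

(** When each coordinate i of f is carried by the single term [c i], the partial
    sums are restrictions of f, and the tail of f bounds the error. *)
Lemma has_sum_disjoint (c : I -> option J) F f : ell2 f ->
  (forall i j, F j i = if c i == Some j then f i else 0) ->
  (forall i, c i = None -> f i = 0) -> has_sum F f.
Proof.
move=> f2 Fc c0; apply/has_sumP => eps eps0.
have [A AP] := ell2_tail f2 eps0.
have FE E i : \sum_(j <- enum_fset E) F j i =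
    if c i is Some j then if j \in E then f i else 0 else 0.
  by under eq_bigr do rewrite Fc; rewrite sum_pick.
exists [fset j in pmap c A]%fset => E AE; apply: AP => i => [iA|];
  rewrite fct_sumE /GRing.add /= /GRing.opp /= FE; case ci: (c i) => [j|].
- by rewrite (fsubsetP AE) ?subrr // !inE mem_pmap -ci map_f.
- by rewrite c0 // subrr.
- by case: ifP; rewrite ?subrr ?subr0 // nsq0 nsq_ge0.
- by rewrite subr0.
Qed.

End Families.
End SquareSums.

(** * Multiplication by an edge in the graph groupoid *)

Section Reduction.
Variable G : digraph.
Implicit Types (e : hedge G) (s : seq (hedge G)) (w u : gpath G).

Lemma reduce_id s : reduced s -> reduce s = s.
Proof.
elim: s => //= e s IHs rs; rewrite IHs; last exact: path_sorted rs.
by case: s rs {IHs} => //= f s /andP [/negbTE ->].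
Qed.

Lemma reduced_cons_red e s : reduced s -> reduced (cons_red e s).
Proof.
case: s => //= f s fs; case: ifPn => [_|nf]; first exact: path_sorted fs.
by rewrite /reduced /= nf.
Qed.

(** With [foldr_cons_red], this says that the edges act on reduced words as a
    free group does, which gives the confluence of the reduction. *)
Lemma cons_redK e s : reduced s -> cons_red (hinv e) (cons_red e s) = s.
Proof.
case: s => [|f s] /=; first by rewrite hinvK eqxx.
case: eqP => [->|_] /=; last by rewrite hinvK eqxx.
by case: s => //= g s /andP [/negbTE ->].
Qed.

Lemma foldr_cons_red e s z : reduced s -> reduced z ->
  foldr (@cons_red G) z (cons_red e s) = cons_red e (foldr (@cons_red G) z s).
Proof.
case: s => //= f s rs rz; case: eqP => // -> /=.
have rfold : reduced (foldr (@cons_red G) z s).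
  by elim: s {rs} => //= g s; exact: reduced_cons_red.
by rewrite -{1}(hinvK e) cons_redK.
Qed.

Lemma reduce_catl s1 s2 : reduce (reduce s1 ++ s2) = reduce (s1 ++ s2).
Proof.
elim: s1 => //= e s1 IHs; rewrite -IHs {1}/reduce !foldr_cat.
by rewrite foldr_cons_red ?reduced_reduce // /reduce foldr_cat.
Qed.

Lemma wend_reduce v s : walk v s -> wend v (reduce s) = wend v s.
Proof.
elim: s v => //= e s IHs v /andP [/eqP <- ws].
rewrite /wend /= -/(wend (htgt e) s) -IHs //.
have := walk_reduce ws; rewrite /cons_red; case: (reduce s) => //= f z.
by have [->|] := eqVneq f (hinv e); rewrite /wend /= ?htgt_inv.
Qed.

Lemma gmul_edgeP w e u : gmul (Some w) (gedge e) = Some u <->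
  [/\ gend w = hsrc e, gstart u = gstart w &
      (gpval u).2 = reduce ((gpval w).2 ++ [:: e])].
Proof.
rewrite /gmul /gedge; case: eqP => we; last by split=> // -[/we].
split=> [[<-] //|[_ s1 s2]]; congr Some; apply: val_inj => /=.
by rewrite -s1 -s2 /gstart; case: (gpval u).
Qed.

Lemma gmul_edge_src w e u : gmul (Some w) (gedge e) = Some u -> gend w = hsrc e.
Proof. by case/gmul_edgeP. Qed.

Lemma gmul_edge_tgt w e u : gmul (Some w) (gedge e) = Some u -> gend u = htgt e.
Proof.
case/gmul_edgeP => we u1 u2; rewrite /gend u2 -/(gstart u) u1 wend_reduce.
  by rewrite /wend map_cat last_cat.
have /andP [ww _] := gpathP w.
by rewrite walk_cat ww /= -/(gend w) we eqxx.
Qed.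

(** In the groupoid, [(w e) e^-1 = w].  All the coordinate formulas below rest on
    this equivalence between [w e = u] and [u e^-1 = w]. *)
Lemma gmul_edge_inv w e u : gmul (Some w) (gedge e) = Some u ->
  gmul (Some u) (gedge (hinv e)) = Some w.
Proof.
move=> weu; apply/gmul_edgeP; rewrite hsrc_inv (gmul_edge_tgt weu).
case/gmul_edgeP: weu => we u1 u2; split => //; rewrite u2 reduce_catl.
have /andP [_ rw] := gpathP w.
by rewrite -catA /= /reduce foldr_cat /= eqxx -/(reduce _) reduce_id.
Qed.

Lemma gmul_edgeE w e u :
  (gmul (Some w) (gedge e) == Some u) =
  (gmul (Some u) (gedge (hinv e)) == Some w).
Proof.
apply/eqP/eqP => /gmul_edge_inv //; by rewrite hinvK.
Qed.

End Reduction.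

Section Incidence.
Variable G : digraph.
Hypothesis lfG : locally_finite G.
Implicit Types (e : hedge G) (v : vert G) (w u : gpath G).

Definition hin v : seq (hedge G) :=
  map inl (enum_fset (fset_set (in_edges v))) ++
  map inr (enum_fset (fset_set (out_edges v))).

Definition hout v : seq (hedge G) := [seq hinv e | e <- hin v].

Lemma finite_out_edges v : finite_set (out_edges v).
Proof. by have := lfG v; rewrite finite_setU => -[]. Qed.

Lemma finite_in_edges v : finite_set (in_edges v).
Proof. by have := lfG v; rewrite finite_setU => -[]. Qed.

Lemma mem_hin v e : (e \in hin v) = (htgt e == v).
Proof.
rewrite mem_cat; case: e => a /=.
- rewrite (mem_map inl_inj) in_fset_set; last exact: finite_in_edges.
  rewrite [X in _ || X](_ : _ = false) ?orbF; last by apply/mapP => -[].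
  by apply/idP/eqP; rewrite inE.
- rewrite (mem_map inr_inj) in_fset_set; last exact: finite_out_edges.
  rewrite [X in X || _](_ : _ = false) /=; last by apply/mapP => -[].
  by apply/idP/eqP; rewrite inE.
Qed.

Lemma hin_uniq v : uniq (hin v).
Proof.
rewrite cat_uniq (map_inj_uniq inl_inj) (map_inj_uniq inr_inj).
rewrite !fset_uniq andbT /=; apply/hasPn => _ /mapP [a _ ->].
by apply/mapP => -[].
Qed.

Lemma mem_hout v e : (e \in hout v) = (hsrc e == v).
Proof.
by rewrite -{1}(hinvK e) (mem_map (inv_inj (@hinvK G))) mem_hin htgt_inv.
Qed.

Lemma hout_uniq v : uniq (hout v).
Proof. by rewrite (map_inj_uniq (inv_inj (@hinvK G))) hin_uniq. Qed.

Lemma size_hin v : size (hin v) = (deg_in v + deg_out v)%N.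
Proof. by rewrite size_cat !size_map. Qed.

Lemma size_hout v : size (hout v) = (deg_in v + deg_out v)%N.
Proof. by rewrite size_map size_hin. Qed.

(** A sum indexed by the edges from w to u can be read from either end. *)
Lemma big_hout_hin (V : nmodType) (P : pred (hedge G)) (F : hedge G -> V) w u :
  (forall e, gmul (Some w) (gedge e) <> Some u -> F e = 0) ->
  \sum_(e <- hout (gend w) | P e) F e = \sum_(e <- hin (gend u) | P e) F e.
Proof.
move=> F0; apply: eq_big_support; rewrite ?hout_uniq ?hin_uniq // => e Fe.
have weu : gmul (Some w) (gedge e) = Some u.
  by apply: contrapT => /F0 /eqP; rewrite (negbTE Fe).
by rewrite mem_hout mem_hin (gmul_edge_src weu) (gmul_edge_tgt weu) !eqxx.
Qed.

End Incidence.

(** * Operators carried by a set of edges *)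

Section Transfer.
Variables (R : realType) (G : digraph).
Hypothesis lfG : locally_finite G.
Implicit Types (e : hedge G) (v : vert G) (w u : gpath G) (P : pred (hedge G)).
Implicit Types (psi : gpath G -> R[i]) (A B U : {fset gpath G}).
Implicit Types (E : {fset hedge G}).

(** The vector [R_e psi], in coordinates. *)
Definition pull e psi : gpath G -> R[i] := fun u =>
  if gmul (Some u) (gedge (hinv e)) is Some w then psi w else 0.

(** The vector [T psi], in coordinates, for the operator T that sends the basis
    vector of w to the sum of the basis vectors of the [w e], e in P. *)
Definition transfer P psi : gpath G -> R[i] := fun u =>
  \sum_(e <- hin (gend u) | P e) pull e psi u.

Definition edge_basis P w : gpath G -> R[i] :=
  \sum_(e <- hout (gend w) | P e) xi R (gmul (Some w) (gedge e)).

Definition restr A psi : gpath G -> R[i] := fun w => if w \in A then psi w else 0.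

Lemma pull_out e psi u : e \notin hin (gend u) -> pull e psi u = 0.
Proof.
rewrite mem_hin //; rewrite /pull; case E: gmul => [w|] //.
by rewrite (gmul_edge_src E) hsrc_inv eqxx.
Qed.

Lemma transfer_pred1 e psi : transfer (pred1 e) psi = pull e psi.
Proof.
apply/funext => u; rewrite /transfer -big_filter.
case: (boolP (e \in hin (gend u))) => eu.
  by rewrite filter_pred1_uniq ?hin_uniq // big_seq1.
rewrite pull_out // big_filter big_seq_cond big1 // => e' /andP [e'u /eqP ee'].
by rewrite -ee' e'u in eu.
Qed.

Lemma transferB P psi1 psi2 :
  transfer P (psi1 - psi2) = transfer P psi1 - transfer P psi2.
Proof.
apply/funext => u; transitivity (transfer P psi1 u - transfer P psi2 u) => //.
rewrite /transfer -sumrB; apply: eq_bigr => e _; rewrite /pull.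
by case: gmul => [w|] //; rewrite subr0.
Qed.

Lemma xi_gmul_edge w e u : xi R (gmul (Some w) (gedge e)) u =
  if gmul (Some u) (gedge (hinv e)) == Some w then 1 else 0.
Proof.
rewrite -gmul_edgeE; case: gmul => [w'|] //=.
by rewrite /basis_vec eq_sym; case: eqP => [->|ne]; case: eqP => // -[].
Qed.

Lemma edge_basis_pred1 e w :
  edge_basis (pred1 e) w = xi R (gmul (Some w) (gedge e)).
Proof.
rewrite /edge_basis -big_filter; case: (boolP (e \in hout (gend w))) => ew.
  by rewrite filter_pred1_uniq ?hout_uniq // big_seq1.
rewrite big_filter big_seq_cond big1 => [|e' /andP [e'w /eqP ee']]; last first.
  by rewrite -ee' e'w in ew.
case E: gmul => [u|] //; move: ew.
by rewrite mem_hout // (gmul_edge_src E) eqxx.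
Qed.

(** The partial sums that define an operator from its values on the basis are
    obtained by applying the coordinate formula to truncations of psi. *)
Lemma sum_edge_basis P psi A :
  \sum_(w <- A) psi w *: edge_basis P w = transfer P (restr A psi).
Proof.
apply/funext => u; rewrite fct_sumE.
transitivity (\sum_(w <- A) \sum_(e <- hin (gend u) | P e)
    (if gmul (Some u) (gedge (hinv e)) == Some w then psi w else 0)).
  apply: eq_bigr => w _.
  transitivity (psi w * edge_basis P w u); first by [].
  rewrite /edge_basis fct_sumE.
  under eq_bigr do rewrite xi_gmul_edge.
  rewrite (@big_hout_hin _ lfG _ P _ w u) => [|e].
    by rewrite mulr_sumr; apply: eq_bigr => e _; case: ifP; rewrite ?mulr1 ?mulr0.
  by move/eqP/negbTE; rewrite gmul_edgeE => ->.
rewrite exchange_big; apply: eq_bigr => e _; rewrite sum_pick /pull.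
by case: gmul.
Qed.

Definition preds P u : {fset gpath G} :=
  [fset w in pmap (fun e => gmul (Some u) (gedge (hinv e)))
               [seq e <- hin (gend u) | P e]]%fset.

Lemma mem_preds P u e w : P e -> gmul (Some u) (gedge (hinv e)) = Some w ->
  w \in preds P u.
Proof.
move=> Pe uew; rewrite !inE mem_pmap -uew; apply: map_f.
by rewrite mem_filter Pe mem_hin // (gmul_edge_src uew) hsrc_inv eqxx.
Qed.

Lemma predsP P u w : w \in preds P u ->
  exists2 e, P e & gmul (Some u) (gedge (hinv e)) = Some w.
Proof.
rewrite !inE mem_pmap => /mapP [e].
by rewrite mem_filter => /andP [Pe _] ->; exists e.
Qed.

Lemma transfer_local P psi1 psi2 u :
  (forall w, w \in preds P u -> psi1 w = psi2 w) ->
  transfer P psi1 u = transfer P psi2 u.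
Proof.
move=> psi12; apply: eq_bigr => e Pe; rewrite /pull.
by case E: gmul => [w|] //; apply: psi12; apply: mem_preds E.
Qed.

Lemma op_of_edge_basis_unique P psi phi :
  op_of_basis (edge_basis P) psi phi -> phi = transfer P psi.
Proof.
case=> _ _ sum_phi; apply/funext => u.
apply: (has_sum_at (A0 := preds P u) sum_phi) => A uA.
have := congr1 (fun f => f u) (sum_edge_basis P psi A).
rewrite /= fct_sumE => ->; apply: transfer_local => w /(fsubsetP uA) wA.
by rewrite /restr wA.
Qed.

Lemma op_of_edge_basis_finite P psi A : (forall w, w \notin A -> psi w = 0) ->
  op_of_basis (edge_basis P) psi (transfer P psi).
Proof.
move=> psiA; split; first exact: ell2_finite psiA.
- pose succs := [fset u in pmap (fun p => gmul (Some p.1) (gedge p.2))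
      [seq (w, e) | w <- enum_fset A, e <- hout (gend w)]]%fset.
  apply: (@ell2_finite _ _ _ succs) => u uA.
  apply: big1_seq => e /andP [Pe _]; rewrite /pull; case E: gmul => [w|] //.
  apply: psiA; apply: contra uA => wA; rewrite !inE mem_pmap.
  have weu := gmul_edge_inv E; rewrite hinvK in weu.
  apply/mapP; exists (w, e) => //; apply/allpairsPdep; exists w, e.
  by split=> //; rewrite mem_hout // (gmul_edge_src weu) eqxx.
- apply/has_sumP => eps eps0; exists A => A' AA' B.
  rewrite sum_edge_basis (_ : restr A' psi = psi).
    by rewrite subrr /ssq big1 ?ltW // => i _; exact: nsq0.
  apply/funext => w; rewrite /restr; case: ifPn => // /negP wA.
  by rewrite psiA //; apply/negP => /(fsubsetP AA').
Qed.

Section BoundedDegree.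
Variables (P : pred (hedge G)) (D : nat).
Hypothesis hinD : forall v, (count P (hin v) <= D)%N.
Hypothesis houtD : forall v, (count P (hout v) <= D)%N.

(** The Schur test: a coordinate of [transfer P psi] is a sum of at most D
    coordinates of psi, and each coordinate of psi occurs at most D times. *)
Lemma ssq_transfer psi (c : R) : (forall A, ssq A psi <= c) ->
  forall B, ssq B (transfer P psi) <= 2 ^+ D * (D%:R * c).
Proof.
move=> psic B.
have D2 : 0 < 2 ^+ D :> R by rewrite exprn_gt0.
pose A := [fset w in flatten [seq enum_fset (preds P u) | u <- enum_fset B]]%fset.
apply: (@le_trans _ _ (2 ^+ D * (D%:R * ssq A psi))); last first.
  by rewrite ler_pM2l // ler_wpM2l ?ler0n.
have -> : D%:R * ssq A psi = \sum_(w <- A) D%:R * nsq (psi w).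
  by rewrite mulr_sumr.
apply: (@le_trans _ _ (\sum_(u <- B) 2 ^+ D *
    \sum_(e <- hin (gend u) | P e) nsq (pull e psi u))).
  apply: ler_sum => u _; rewrite /transfer -[X in nsq X]big_filter.
  rewrite -[X in _ <= _ * X]big_filter.
  apply: (le_trans (nsq_sum _ _)); apply: ler_wpM2r.
    by apply: sumr_ge0 => e _; exact: nsq_ge0.
  by rewrite ler_weXn2l ?ler1n // size_filter.
rewrite -mulr_sumr ler_pM2l //.
have -> : \sum_(u <- B) \sum_(e <- hin (gend u) | P e) nsq (pull e psi u) =
    \sum_(u <- B) \sum_(w <- A) \sum_(e <- hin (gend u) | P e)
      (if gmul (Some u) (gedge (hinv e)) == Some w then nsq (psi w) else 0).
  rewrite big_seq [RHS]big_seq; apply: eq_bigr => u uB.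
  rewrite exchange_big; apply: eq_bigr => e Pe; rewrite sum_pick /pull.
  case E: gmul => [w|]; last exact: nsq0.
  rewrite ifT // !inE; apply/flattenP; exists (enum_fset (preds P u)).
    exact: map_f.
  exact: mem_preds E.
rewrite exchange_big; apply: ler_sum => w _.
apply: (@le_trans _ _ (\sum_(u <- B) \sum_(e <- hout (gend w) | P e)
      (if gmul (Some w) (gedge e) == Some u then nsq (psi w) else 0))).
  apply: ler_sum => u _.
  rewrite (@big_hout_hin _ lfG _ P _ w u) => [|e /eqP/negbTE -> //].
  by under eq_bigr do rewrite -gmul_edgeE.
rewrite exchange_big.
apply: (@le_trans _ _ (\sum_(e <- hout (gend w) | P e) nsq (psi w))).
  apply: ler_sum => e _; rewrite sum_pick.
  case: (gmul (Some w) (gedge e)) => [u|] /=; last by exact: nsq_ge0.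
  by case: ifP => // _; exact: nsq_ge0.
rewrite big_const_seq iter_addr_0 -[X in X <= _]mulr_natl ler_wpM2r ?nsq_ge0 //.
by rewrite ler_nat.
Qed.

Lemma op_of_edge_basis_bounded psi :
  ell2 psi -> op_of_basis (edge_basis P) psi (transfer P psi).
Proof.
move=> psi2; split=> //.
  have /ell2P [c psic] := psi2; apply/ell2P; eexists; exact: ssq_transfer psic.
apply/has_sumP => eps eps0.
(* [D.+1] rather than [D] keeps K positive when D is 0. *)
pose K : R := 2 ^+ D * D.+1%:R.
have K0 : 0 < K by rewrite mulr_gt0 ?exprn_gt0 ?ltr0n.
have [|A AP] := ell2_tail psi2 (eps := eps / K); first by rewrite divr_gt0.
exists A => A' AA' B; rewrite sum_edge_basis -transferB.
apply: (@le_trans _ _ (2 ^+ D * (D%:R * (eps / K)))).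
  apply: ssq_transfer => B'; apply: AP => w;
    rewrite /GRing.add /= /GRing.opp /= /restr.
    by move=> /(fsubsetP AA') ->; rewrite subrr.
  by case: ifP; rewrite ?subrr ?subr0 // nsq0 nsq_ge0.
rewrite mulrA mulrCA ler_piMr ?(ltW eps0) // ler_pdivrMr // mul1r.
by rewrite ler_pM2l ?exprn_gt0 // ler_nat.
Qed.

End BoundedDegree.

Lemma right_mul_pull e psi : ell2 psi -> right_mul (gedge e) psi (pull e psi).
Proof.
move=> psi2; rewrite -transfer_pred1.
have -> : right_mul (R := R) (gedge e) = op_of_basis (edge_basis (pred1 e)).
  by congr op_of_basis; apply/funext => w; rewrite edge_basis_pred1.
apply: (@op_of_edge_basis_bounded _ 1) => // v;
  by rewrite count_uniq_mem ?hin_uniq ?hout_uniq // leq_b1.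
Qed.

(** At most one edge of P enters the end of a given u, so the [pull e psi] have
    disjoint supports. *)
Lemma edge_sum_in P psi :
  (forall e f, P e -> P f -> htgt e = htgt f -> e = f) ->
  ell2 (transfer P psi) ->
  has_sum (fun e => if P e then pull e psi else 0) (transfer P psi).
Proof.
move=> Pin phi2.
pose c u := ohead [seq e <- hin (gend u) | P e].
apply: (has_sum_disjoint (c := c)) => //.
  move=> u e; rewrite /c /transfer -big_filter.
  have mem_s f :
      (f \in [seq e <- hin (gend u) | P e]) = P f && (htgt f == gend u).
    by rewrite mem_filter mem_hin.
  have : uniq [seq e <- hin (gend u) | P e] by rewrite filter_uniq ?hin_uniq.
  case: [seq _ <- _ | _] mem_s => [|f [|g s]] mem_s /=.
  - move=> _; case: ifP => // Pe; apply: pull_out; rewrite mem_hin //.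
    by have := mem_s e; rewrite Pe /= => <-.
  - move=> _; rewrite big_seq1 (inj_eq Some_inj) eq_sym; have := mem_s e.
    rewrite inE; case: eqP => [->|_] /esym; first by case/andP => ->.
    move/nandP; rewrite -mem_hin //; case: ifP => // Pe [//|].
    exact: pull_out.
  - have /andP [Pf /eqP fu] : P f && (htgt f == gend u).
      by rewrite -mem_s !inE eqxx.
    have /andP [Pg /eqP gu] : P g && (htgt g == gend u).
      by rewrite -mem_s !inE eqxx orbT.
    by rewrite !inE (Pin f g) ?fu // eqxx.
move=> u; rewrite /c /transfer -big_filter.
by case: [seq _ <- _ | _] => // _; rewrite big_nil.
Qed.

(** Each w has at most one successor [w e] with e in P, so the sum over the edges
    outside E is the sum over the paths w whose successor uses such an edge.
    Once E contains the edges used by a finite set A0, these paths are outside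
    A0, and the convergence over the paths bounds any sum over them. *)
Lemma edge_sum_out P psi :
  (forall e f, P e -> P f -> hsrc e = hsrc f -> e = f) ->
  op_of_basis (edge_basis P) psi (transfer P psi) ->
  has_sum (fun e => if P e then pull e psi else 0) (transfer P psi).
Proof.
move=> Pout [_ _ /has_sumP sumP]; apply/has_sumP => eps eps0.
have [|A0 A0P] := sumP (eps / 4); first by rewrite divr_gt0.
exists [fset e in flatten [seq hout (gend w) | w <- enum_fset A0]]%fset.
move=> E A0E U.
have outE w e : w \in A0 -> e \in hout (gend w) -> e \in E.
  move=> wA0 ew; apply: (fsubsetP A0E); rewrite !inE.
  by apply/flattenP; exists (hout (gend w)) => //; apply: map_f.
(* A adds to A0 the paths that contribute, at some u in U, to the sum over the
   edges outside E; the error on U is then the difference of two partial sums. *)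
pose Q e := P e && (e \notin E).
pose A := (A0 `|` [fset w in flatten
  [seq enum_fset (preds Q u) | u <- enum_fset U]])%fset.
have := A0P A (fsubsetUl _ _) U; have := A0P A0 (fsubset_refl _) U.
rewrite !sum_edge_basis => le0 le1.
have subE (f g : gpath G -> R[i]) u : (f - g) u = f u - g u by [].
have addE (f g : gpath G -> R[i]) u : (f + g) u = f u + g u by [].
have oppE (f : gpath G -> R[i]) u : (- f) u = - f u by [].
have -> : ssq U (transfer P psi - \sum_(e <- E) (if P e then pull e psi else 0)) =
    ssq U ((transfer P psi - transfer P (restr A0 psi)) +
           - (transfer P psi - transfer P (restr A psi))).
  apply: eq_big_seq => u uU; congr nsq.
  rewrite addE oppE !subE opprB [RHS]addrC addrA subrK -[RHS]subE -transferB.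
  rewrite fct_sumE.
  pose F e := if P e && (e \in E) then pull e psi u else 0.
  have -> : \sum_(e <- E) (if P e then pull e psi else 0) u =
      \sum_(e <- hin (gend u)) F e.
    transitivity (\sum_(e <- E) F e).
      by apply: eq_big_seq => e eE; rewrite /F eE andbT; case: ifP.
    apply: eq_big_support; rewrite ?fset_uniq ?hin_uniq // => e.
    rewrite /F; case: ifP => [/andP [_ ->] /=|_]; last by rewrite eqxx.
    by apply: contraNT; move/pull_out => ->.
  rewrite /transfer big_mkcond [RHS]big_mkcond -sumrB; apply: eq_bigr => e _ /=.
  rewrite /F; case: ifP => Pe /=; last by rewrite subrr.
  rewrite /pull; case ue : (gmul (Some u) (gedge (hinv e))) => [w|]; last first.
    by case: ifP; rewrite subrr.
  have we := gmul_edge_tgt ue; rewrite htgt_inv in we.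
  rewrite subE /restr.
  case: (boolP (e \in E)) => eE.
    have wA : w \in A -> w \in A0.
      rewrite !inE => /orP [//|/flattenP [_ /mapP [u' _ ->]]].
      case/predsP => f /andP [Pf fE] u'f.
      have wf := gmul_edge_tgt u'f; rewrite htgt_inv in wf.
      by move: fE; rewrite (Pout f e) ?eE // -wf.
    have -> : (w \in A) = (w \in A0).
      by apply/idP/idP => // wA0; rewrite in_fsetU wA0.
    by rewrite !subrr.
  have wQ : w \in A.
    rewrite in_fsetU; apply/orP; right; rewrite !inE.
    apply/flattenP; exists (enum_fset (preds Q u)); first exact: map_f.
    by apply: mem_preds ue; rewrite /Q Pe.
  have wA0 : w \notin A0.
    by apply: contra eE => wA0; apply: (outE w) => //; rewrite mem_hout // we.
  by rewrite wQ (negbTE wA0).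
apply: (le_trans (ssqD _ _ _)).
have -> f : ssq U (- f) = ssq U f by apply: eq_bigr => u _; exact: nsqN.
lra.
Qed.

End Transfer.

(** * The labeling operators *)

Section Labels.
Variables (R : realType) (G : digraph) (N : nat) (lab : edge G -> 'I_N).
Hypothesis lfG : locally_finite G.
Implicit Types (neg : bool) (k : 'I_N) (psi : gpath G -> R[i]).

(** The label of index k, positive or negative according to [neg], as a predicate
    independent of the field of scalars. *)
Definition has_label neg k : pred (hedge G) := fun e =>
  match e with inl a => ~~ neg && (lab a == k) | inr a => neg && (lab a == k) end.

Lemma label_eqE neg k e : label R lab e = t R neg k <-> has_label neg k e.
Proof.
have dN i j : delta_mx 0 i <> - delta_mx 0 j :> 'rV[R[i]]_N.
  move=> /matrixP /(_ 0 i) /eqP; rewrite !mxE !eqxx /= -addr_eq0.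
  by rewrite -natrD pnatr_eq0.
have dI i j : delta_mx 0 i = delta_mx 0 j :> 'rV[R[i]]_N -> i = j.
  move=> /matrixP /(_ 0 i) /eqP; rewrite !mxE !eqxx /=.
  by have [|_] := eqVneq i j; rewrite //= oner_eq0.
rewrite /label /t; case: e neg => a [] /=; split=> //.
- by move/dN.
- by move/dI ->.
- by move/eqP ->.
- by move/oppr_inj/dI ->.
- by move/eqP ->.
- by move/esym/dN.
Qed.

Lemma labeling_op_kE neg k :
  labeling_op_k (R := R) lab neg k = op_of_basis (edge_basis R (has_label neg k)).
Proof.
congr op_of_basis; apply/funext => w; rewrite /labeling_basis /edge_basis.
rewrite -[RHS]big_filter [RHS]fsbig_seq ?filter_uniq ?hout_uniq //.
rewrite (_ : [set e | _ /\ _]%classic =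
  [set` [seq e <- hout (gend w) | has_label neg k e]]%classic) //.
apply/seteqP; split=> e /=; rewrite mem_filter mem_hout //.
- case=> we /label_eqE ->; move: we.
  case E: (gmul (Some w) (gedge e)) => [u|] // _.
  by rewrite (gmul_edge_src E) eqxx.
- case/andP => /label_eqE le /eqP we; split => //.
  by rewrite /gmul; case: eqP => // ne _; exact: ne (esym we).
Qed.

Lemma sum_has_label (e : hedge G) psi :
  \sum_(j < N) (if has_label true j e then pull e psi else 0) +
  \sum_(j < N) (if has_label false j e then pull e psi else 0) = pull e psi.
Proof.
case: e => a /=; [rewrite big1 // add0r | rewrite [X in _ + X]big1 // addr0];
  by rewrite -big_mkcond /= (eq_bigl (pred1 (lab a))) ?big_pred1_eq // => j;
     rewrite /= eq_sym.
Qed.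

(** The vectors T_k psi are determined by psi: convergence in norm forces their
    coordinates. *)
Lemma labeling_opE psi phi : labeling_op (R := R) lab psi phi <->
  [/\ forall neg k, op_of_basis (edge_basis R (has_label neg k)) psi
                      (transfer (has_label neg k) psi), ell2 psi &
      phi = \sum_(j < N) transfer (has_label true j) psi +
            \sum_(j < N) transfer (has_label false j) psi].
Proof.
split=> [[phi_ [psi2 phi_P ->]]|[opP psi2 ->]].
  have phiE neg k : phi_ neg k = transfer (has_label neg k) psi.
    by apply: op_of_edge_basis_unique => //; rewrite -labeling_op_kE.
  split=> // [neg k|]; first by rewrite -phiE -labeling_op_kE.
  by congr (_ + _); apply: eq_bigr => j _; rewrite phiE.
exists (fun neg k => transfer (has_label neg k) psi); split=> // neg k.
by rewrite labeling_op_kE.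
Qed.

End Labels.

Theorem corollary5p2 (R : realType) (G : digraph) (N : nat)
    (lab : edge G -> 'I_N)
    (G_locally_finite : locally_finite G)
    (G_connected : connected G)
    (G_max_deg : max_deg_out G N)
    (lab_canonical : canonical_labeling lab) :
  let T_G := labeling_op (R := R) lab in
  let sum_R := op_sum (fun e : hedge G => right_mul (R := R) (gedge e)) in
  [/\ forall psi phi : gpath G -> R[i], T_G psi phi -> sum_R psi phi,
      forall psi : gpath G -> R[i], finite_set [set w | psi w <> 0%R]%classic -> exists phi, T_G psi phi &
      (exists M : nat, forall v : vert G, (deg_in v <= M)%N) ->
        forall psi : gpath G -> R[i], ell2 psi -> exists phi, T_G psi phi].
Proof.
move=> T_G sum_R; have lfG := G_locally_finite; split.
- move=> psi phi /(labeling_opE _ lfG) [opP psi2 ->].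
  have trans2 neg k : ell2 (transfer (has_label lab neg k) psi).
    by case: (opP neg k).
  exists (fun e => pull e psi); split.
  + by move=> e; apply: right_mul_pull.
  + by apply: ell2D; apply: (@big_ind _ (@ell2 R _)) => //;
      do ?[exact: ell2_0 | exact: ell2D].
  rewrite (_ : (fun e => _) =
    \sum_(j < N) (fun e => if has_label lab true j e then pull e psi else 0) +
    \sum_(j < N) (fun e => if has_label lab false j e then pull e psi else 0)).
    apply: has_sumD; apply: has_sum_big => k.
      (* The opposite edges entering a vertex come from the edges leaving it,
         which the canonical labeling separates. *)
      apply: edge_sum_in => // -[a|a] [b|b] //= /eqP la /eqP lb ab.
      have [_ lab_inj] := lab_canonical (src a).
      by congr inr; apply: lab_inj; rewrite // la lb.
    apply: edge_sum_out => // -[a|a] [b|b] //= /eqP la /eqP lb ab.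
    have [_ lab_inj] := lab_canonical (src a).
    by congr inl; apply: lab_inj; rewrite // la lb.
  by apply/funext => e; rewrite !fct_sumE /= -[LHS](sum_has_label lab).
- move=> psi finpsi; eexists; apply/(labeling_opE _ lfG).
  have psi0 w : w \notin fset_set [set w | psi w <> 0]%classic -> psi w = 0.
    by rewrite in_fset_set // notin_setE /= => /contrapT.
  split; [|exact: ell2_finite psi0|by []].
  by move=> neg k; exact: op_of_edge_basis_finite psi0.
- case=> M degM psi psi2; eexists; apply/(labeling_opE _ lfG).
  split=> // neg k; apply: (@op_of_edge_basis_bounded _ _ _ _ (M + N)) => // v;
    rewrite (leq_trans (count_size _ _)) // ?size_hin ?size_hout;
    by apply: leq_add; [exact: degM | case: G_max_deg].
Qed.
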